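(* Let $L>0$, $\epsilon_1,\epsilon_2\in(0,\infty)$, and let $k\ge 2$ be an integer. Let $f\in C(\mathbb{R})$ be $2L$-periodic, and let $h:\mathbb{R}\to\mathbb{R}$ be a $2L$-periodic function with $h\in C^k(\mathbb{R})$ and $h(x)>0$ for all $x\in\mathbb{R}$. Put $\Omega_1=\{(x,y)\in\mathbb{R}^2: 0<y<h(x)\}$, $\Omega_2=\{(x,y)\in\mathbb{R}^2: y>h(x)\}$, $\Gamma_I=\{(x,y)\in\mathbb{R}^2: y=h(x)\}$ and $\Gamma_0=\{(x,y)\in\mathbb{R}^2: y=0\}$. Consider the transmission problem of finding $\phi_1\in BC^2(\bar\Omega_1)$ and $\phi_2\in BC^2(\bar\Omega_2)$ such that $$\Delta\phi_\alpha=0\ \text{ in }\Omega_\alpha\quad(\alpha=1,2),$$ $$\phi_1=\phi_2\ \text{ on }\Gamma_I,\qquad \epsilon_1\frac{\partial\phi_1}{\partial\nu}=\epsilon_2\frac{\partial\phi_2}{\partial\nu}\ \text{ on }\Gamma_I,$$ $$\phi_1(x,y)=f(x)\ \text{ on }\Gamma_0,\qquad \frac{\partial\phi_2}{\partial y}(x,y)\to 0\ \text{ as } y\to\infty.$$ If a solution $\phi_\alpha\in BC^2(\bar\Omega_\alpha)$, $\alpha=1,2$, of this problem exists, then it is unique.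
   Context: For $\alpha=1,2$, $BC^2(\bar\Omega_\alpha)$ denotes the space of bounded functions in $C^2(\Omega_\alpha)$ that can be continuously extended into the closure $\bar\Omega_\alpha$. The vector $\nu$ is the unit normal vector to $\Gamma_I$ pointing out of $\Omega_1$, and $\partial/\partial\nu$ denotes the derivative in the direction $\nu$. The constant $\epsilon_\alpha$ is the dielectric constant in $\Omega_\alpha$. *)

(* Defs.v *)
From HB Require Import structures.
From mathcomp Require Import all_boot all_order all_algebra.
From mathcomp Require Import all_classical all_reals all_analysis.
From mathcomp Require Import ring.
Set Implicit Arguments.
Unset Strict Implicit.
Unset Printing Implicit Defensive.
Import Order.TTheory GRing.Theory Num.Theory numFieldNormedType.Exports.
Local Open Scope classical_set_scope.
Local Open Scope ring_scope.

Definition Ck (R : realType) (k : nat) (g : R -> R) : Prop :=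
  (forall i x, (i < k)%N -> derivable (derive1n i g) x 1) /\
  continuous (derive1n k g).

Definition dirx (R : realType) : R * R := (1, 0).
Definition diry (R : realType) : R * R := (0, 1).

(* All partial derivatives of order at most k exist and are continuous on A;
   used for open A only. *)
Fixpoint Ck_on (R : realType) (k : nat) (A : set (R * R)) (u : R * R -> R)
    : Prop :=
  (forall p, A p -> {for p, continuous u}) /\
  match k with
  | 0 => True
  | k'.+1 =>
      (forall p, A p -> derivable u p (dirx R) /\ derivable u p (diry R)) /\
      Ck_on k' A ('D_(dirx R) u) /\ Ck_on k' A ('D_(diry R) u)
  end.

(* The total function u stands for its restriction to the closure of A, i.e.
   an element of the space is identified with its continuous extension; the
   values of u outside that closure are irrelevant.  Only u itself, not its
   derivatives, is required to be bounded and to extend to the closure. *)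
Definition BC2_closure (R : realType) (A : set (R * R)) (u : R * R -> R)
    : Prop :=
  [/\ Ck_on 2 A u, [bounded u p | p in A] & {within closure A, continuous u}].

Definition laplacian (R : realType) (u : R * R -> R) (p : R * R) : R :=
  'D_(dirx R) ('D_(dirx R) u) p + 'D_(diry R) ('D_(diry R) u) p.

Definition Omega1 (R : realType) (h : R -> R) : set (R * R) :=
  [set p | 0 < p.2 /\ p.2 < h p.1].
Definition Omega2 (R : realType) (h : R -> R) : set (R * R) :=
  [set p | h p.1 < p.2].
Definition GammaI (R : realType) (h : R -> R) : set (R * R) :=
  [set p | p.2 = h p.1].
Definition Gamma0 (R : realType) : set (R * R) := [set p | p.2 = 0].

(* The unit normal to the graph of h at (p.1, h p.1), pointing upwards, hence
   out of Omega1; see normal_unit, normal_orthogonal, normal_out_of_Omega1 and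
   normal_from_Omega1. *)
Definition normal (R : realType) (h : R -> R) (p : R * R) : R * R :=
  (Num.sqrt (1 + derive1 h p.1 ^+ 2))^-1 *: (- derive1 h p.1, 1).

(* One-sided derivatives at p in the direction v, taken through the points
   p + t v with t < 0 (resp. t > 0).  At an interface point and for v = nu
   these points lie in Omega1 (resp. Omega2), so that the two relations are the
   normal derivative seen from either side of the interface. *)
Definition derivative_from_minus (R : realType) (u : R * R -> R)
    (p v : R * R) (d : R) : Prop :=
  t^-1 * (u (p + t *: v) - u p) @[t --> 0^'-] --> d.
Definition derivative_from_plus (R : realType) (u : R * R -> R)
    (p v : R * R) (d : R) : Prop :=
  t^-1 * (u (p + t *: v) - u p) @[t --> 0^'+] --> d.

Record transmission_solution (R : realType) (eps1 eps2 : R) (f h : R -> R)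
    (phi1 phi2 : R * R -> R) : Prop := TransmissionSolution {
  ts_space1 : BC2_closure (Omega1 h) phi1;
  ts_space2 : BC2_closure (Omega2 h) phi2;
  ts_harmonic1 : forall p, Omega1 h p -> laplacian phi1 p = 0;
  ts_harmonic2 : forall p, Omega2 h p -> laplacian phi2 p = 0;
  ts_continuity : forall p, GammaI h p -> phi1 p = phi2 p;
  ts_flux : forall p, GammaI h p -> exists d1 d2 : R,
    [/\ derivative_from_minus phi1 p (normal h p) d1,
        derivative_from_plus phi2 p (normal h p) d2
      & eps1 * d1 = eps2 * d2];
  ts_dirichlet : forall p, @Gamma0 R p -> phi1 p = f p.1;
  ts_infinity : forall x : R, 'D_(diry R) phi2 (x, y) @[y --> +oo] --> (0 : R)
}.

Section normal_facts.
Variables (R : realType) (h : R -> R).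
Implicit Types p : R * R.

Let s_gt0 p : 0 < Num.sqrt (1 + derive1 h p.1 ^+ 2).
Proof. by rewrite sqrtr_gt0 ltr_wpDr// sqr_ge0. Qed.

Lemma normal_unit p : (normal h p).1 ^+ 2 + (normal h p).2 ^+ 2 = 1.
Proof.
have s0 := s_gt0 p.
have s2 : Num.sqrt (1 + derive1 h p.1 ^+ 2) ^+ 2 = 1 + derive1 h p.1 ^+ 2.
  by rewrite sqr_sqrtr// addr_ge0// sqr_ge0.
rewrite /normal /= /GRing.scale /=; move: s0 s2; set s := Num.sqrt _ => s0 s2.
rewrite mulr1 exprMn sqrrN -[X in _ + X]mul1r exprVn.
rewrite mulrC -mulrDl [_ + 1]addrC -s2 divff// expf_neq0// gt_eqF//.
Qed.

Lemma normal_orthogonal p : (normal h p).1 * 1 + (normal h p).2 * derive1 h p.1 = 0.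
Proof. by rewrite /normal /= /GRing.scale /=; ring. Qed.

Lemma normal_transversal p : 0 < (normal h p).2 - derive1 h p.1 * (normal h p).1.
Proof.
rewrite /normal /= /GRing.scale /= mulr1 mulrCA mulrN -expr2.
rewrite -[X in X - _]mulr1 -mulrBr opprK mulr_gt0 ?invr_gt0//.
by rewrite ltr_wpDr// sqr_ge0.
Qed.

Let height p (t : R) := (p + t *: normal h p).2 - h (p + t *: normal h p).1.

Let is_derive_height p : derivable h p.1 1 ->
  is_derive (0 : R) 1 (height p) ((normal h p).2 - derive1 h p.1 * (normal h p).1).
Proof.
move=> dh.
have dh' : is_derive (p.1 + 0 * (normal h p).1) 1 h (derive1 h p.1).
  by rewrite mul0r addr0; apply: DeriveDef => //; rewrite derive1E.
have d1 : is_derive (0 : R) 1 (fun t : R => p.1 + t * (normal h p).1)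
    (normal h p).1.
  have -> : (fun t : R => p.1 + t * (normal h p).1)
      = cst p.1 + (normal h p).1 *: id.
    by apply/funext => t; rewrite !fctE mulrC.
  by apply: is_derive_eq; rewrite add0r /GRing.scale /= mulr1.
have d2 : is_derive (0 : R) 1 (fun t : R => p.2 + t * (normal h p).2)
    (normal h p).2.
  have -> : (fun t : R => p.2 + t * (normal h p).2)
      = cst p.2 + (normal h p).2 *: id.
    by apply/funext => t; rewrite !fctE mulrC.
  by apply: is_derive_eq; rewrite add0r /GRing.scale /= mulr1.
have d3 := @is_derive1_comp _ h _ 0 _ _ dh' d1.
exact: is_deriveB.
Qed.

Let height_sign p : GammaI h p -> derivable h p.1 1 ->
  \forall t \near (0 : R)^', 0 < t^-1 * height p t.
Proof.
move=> hp dh; have [dl dE] := is_derive_height dh.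
have h0 : height p 0 = 0.
  by rewrite /height scale0r addr0 -hp subrr.
have c : t^-1 * height p t @[t --> (0 : R)^'] -->
    (normal h p).2 - derive1 h p.1 * (normal h p).1.
  rewrite -dE; move: dl; rewrite /derivable.
  have -> : (fun t : R => t^-1 *: ((height p \o shift 0) (t *: 1) - height p 0))
      = (fun t => t^-1 * height p t).
    by apply/funext => t; rewrite /= h0 subr0 addr0 /GRing.scale /= mulr1.
  rewrite /derive.
  have -> : (fun t : R => t^-1 *: ((height p \o shift 0) (t *: 1) - height p 0))
      = (fun t => t^-1 * height p t).
    by apply/funext => t; rewrite /= h0 subr0 addr0 /GRing.scale /= mulr1.
  by [].
exact: (cvgr_gt _ c _ (normal_transversal p)).
Qed.

Lemma normal_out_of_Omega1 p : GammaI h p -> derivable h p.1 1 ->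
  \forall t \near (0 : R)^'+, Omega2 h (p + t *: normal h p).
Proof.
move=> hp dh; have := height_sign hp dh.
rewrite /at_right /dnbhs !near_withinE => H; near=> t => t0.
have t0' : t != 0 by rewrite gt_eqF.
have : 0 < t^-1 * height p t by move: t0'; near: t.
by rewrite pmulr_rgt0 ?invr_gt0// /height subr_gt0.
Unshelve. all: by end_near. Qed.

Lemma normal_from_Omega1 p : GammaI h p -> derivable h p.1 1 -> 0 < h p.1 ->
  \forall t \near (0 : R)^'-, Omega1 h (p + t *: normal h p).
Proof.
move=> hp dh hgt0; have := height_sign hp dh.
rewrite /at_left /dnbhs !near_withinE => H; near=> t => t0.
have t0' : t != 0 by rewrite lt_eqF.
have : 0 < t^-1 * height p t by move: t0'; near: t.
rewrite nmulr_rgt0 ?invr_lt0// /height subr_lt0 => ?; split => //.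
near: t.
have c : p.2 + t * (normal h p).2 @[t --> (0 : R)] --> p.2.
  rewrite -[X in _ --> X]addr0 -[X in _ --> _ + X](mul0r (normal h p).2).
  apply: (@cvgD _ R); first exact: cvg_cst.
  by apply: (@cvgM R _ _ _ id (cst _)); [exact: cvg_id|exact: cvg_cst].
by apply: (cvgr_gt _ c); rewrite hp.
Unshelve. all: by end_near. Qed.

End normal_facts.

(* Main.v *)
Require Import Defs.
From HB Require Import structures.
From mathcomp Require Import all_boot all_order all_algebra.
From mathcomp Require Import all_classical all_reals all_analysis.
From mathcomp Require Import ring lra.
Import Order.TTheory GRing.Theory Num.Theory numFieldNormedType.Exports.
Local Open Scope classical_set_scope.
Local Open Scope ring_scope.
Set Implicit Arguments.
Unset Strict Implicit.
Unset Printing Implicit Defensive.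

(** Two solutions differ by a pair [w1], [w2] of bounded functions, harmonic in
    [Omega1 h] and [Omega2 h], equal and with matching weighted normal
    derivatives on the interface, and with [w1] zero on the bottom line.  It is
    enough to show [w1 <= 0] and [w2 <= 0], since the two solutions play
    symmetric roles ([transmission_le]).

    The domains are unbounded, so the maximum principle needs a barrier: a pair
    [B1], [B2] of functions that tend to infinity at infinity, agree on the
    interface, are strictly superharmonic, satisfy
    [eps2 * d(B2)/d(nu) < eps1 * d(B1)/d(nu)] on the interface, and with [B1]
    nonnegative on the bottom line ([transmission_barrier]).  Fix [delta > 0]
    and suppose that [w1 - delta * B1] or [w2 - delta * B2] takes a positive
    value.  As the [w]s are bounded and the [B]s coercive, the pair attains a
    positive maximum ([coercive_max2]).  The maximum point is not
    - on the bottom line, where [w1] is zero and [B1] is nonnegative;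
    - inside a domain, where the second derivative test in the two coordinate
      directions would make [- delta * laplacian B] nonpositive
      ([no_interior_max]);
    - on the interface: the difference quotients along [nu] would give
      [d(w1)/d(nu) >= delta * d(B1)/d(nu)] and
      [d(w2)/d(nu) <= delta * d(B2)/d(nu)], and the flux condition on the [w]s
      would contradict the strict flux inequality on the [B]s
      ([no_interface_max]).
    So [w1 <= delta * B1] and [w2 <= delta * B2] for all [delta > 0], and
    [delta] tends to 0.

    The barrier ([barrier_exists]) is
      [B2 = C + ln (x^2 + (y + 1)^2) - exp (- y)],
      [B1 = B2 + A * (1 - exp (lam * (h x - y)))].
    The logarithm is harmonic away from its pole (0, -1), below both domains,
    and supplies the growth; [- exp (- y)] makes [B2] strictly superharmonic.
    The last term of [B1] is zero on the interface, is bounded, and has normal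
    slope at least [A * lam] there, which creates the flux jump when [A] is
    large.  It is superharmonic as soon as [lam] exceeds the supremum of the
    absolute value of the second derivative of [h].  That supremum is finite,
    and so is that of [h], because [h] is periodic and twice continuously
    differentiable. *)

(** * Second derivatives of functions of one variable *)

Section SecondDerivative.
Context {R : realType}.

Lemma derivable1_continuous (g : R -> R) (x : R) :
  derivable g x 1 -> {for x, continuous g}.
Proof. by move=> /derivable1_diffP/differentiable_continuous. Qed.

(** The first derivative [g'] is a parameter, and only has to be the derivative
    near [t]: a function restricted to a line is differentiable only near the
    base point, where its derivative is known in closed form. *)
Definition twice_derivable (g g' : R -> R) (t d : R) : Prop :=
  (\forall s \near t, is_derive (s : R) 1 g (g' s)) /\ is_derive (t : R) 1 g' d.

(** If [d] were positive, [g'], which is zero at the maximum point [t], would be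
    positive just to the right of [t], and the mean value theorem would give
    values of [g] above [g t]. *)
Lemma second_derivative_at_max (g g' : R -> R) (t d : R) :
  twice_derivable g g' t d -> (\forall s \near t, g s <= g t) -> d <= 0.
Proof.
move=> [Dg Dg'] gmax; rewrite leNgt; apply/negP => d0.
have [e /= e0 He] : \forall e \near 0^'+, forall s, `|t - s| < e ->
    is_derive (s : R) 1 g (g' s) /\ g s <= g t.
  have [e /= e0 He] : \forall s \near t,
      is_derive (s : R) 1 g (g' s) /\ g s <= g t.
    by near=> s; split; near: s.
  exists e => //= x /=; rewrite sub0r normrN => xe x0 s xs; apply: He => /=.
  by rewrite (lt_trans xs)// (le_lt_trans (ler_norm _) xe).
pose e1 := e / 2.
have e10 : 0 < e1 by rewrite divr_gt0.
have {}He : forall s, `|t - s| < e1 ->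
    is_derive (s : R) 1 g (g' s) /\ g s <= g t.
  apply: He => //=; rewrite sub0r normrN gtr0_norm//.
  by rewrite ltr_pdivrMr// mulr_natr mulr2n ltrDl.
have inball s : s \in `]t - e1, t + e1[ -> `|t - s| < e1.
  by rewrite in_itv/= distrC ltr_distl.
have g't : g' t = 0.
  have [|Dgt _] := He t; first by rewrite subrr normr0.
  have tle : t - e1 <= t + e1 by rewrite lerD2l ge0_cp ?ltW.
  have [_ <-] : is_derive (t : R) 1 g 0.
    apply: (derive1_at_max tle) => [s /inball/He[[]]|| s /inball/He[]]//.
    by rewrite in_itv/= ltrBlDr !ltrDl e10.
  by case: Dgt.
have [r /= r0 Hr] : \forall x \near 0^'+, 0 < g' (t + x).
  case: Dg' => cg' dg'.
  have : h^-1 *: (g' (h *: 1 + t) - g' t) @[h --> 0^'] --> d by rewrite -dg'.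
  move=> /(cvgr_gt _) /(_ _ d0); rewrite /dnbhs /at_right !near_withinE.
  apply: filterS => x Hx x0.
  have := Hx (lt0r_neq0 x0).
  by rewrite g't subr0 pmulr_rgt0 ?invr_gt0// /GRing.scale/= mulr1 addrC.
pose b := Num.min e1 r / 2.
have b0 : 0 < b by rewrite divr_gt0// lt_min e10 r0.
have bm : b < Num.min e1 r.
  by rewrite ltr_pdivrMr// mulr_natr mulr2n ltrDl lt_min e10 r0.
have [be br] : b < e1 /\ b < r by move: bm; rewrite lt_min => /andP.
have itvb s : s \in `[t, t + b] -> `|t - s| < e1.
  rewrite in_itv/= distrC => /andP[ts sb].
  by rewrite ger0_norm ?subr_ge0// ltrBlDl (le_lt_trans sb)// ltrD2l.
have [c] : exists2 c, c \in `]t, t + b[ & g (t + b) - g t = g' c * (t + b - t).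
  apply: MVT => [|s /subset_itv_oo_cc/itvb/He[]//|]; first by rewrite ltrDl.
  apply: continuous_in_subspaceT => s; rewrite inE/= => /itvb/He[[+ _] _].
  exact: derivable1_continuous.
rewrite in_itv/= addrAC subrr add0r => /andP[tc cb] E.
have : g (t + b) <= g t.
  by apply: (He _ _).2; apply: itvb; rewrite in_itv/= lexx lerDl ltW.
rewrite -subr_le0 E leNgt => /negP; apply; rewrite mulr_gt0//.
rewrite -(subrKC t c) addrC; have := Hr (c - t).
rewrite /= sub0r normrN gtr0_norm ?subr_gt0//.
by rewrite addrC; apply; rewrite // ltrBlDl (lt_trans cb)// ltrD2l.
Unshelve. all: by end_near. Qed.

Lemma twice_derivableD (g g' k k' : R -> R) (t d e : R) :
  twice_derivable g g' t d -> twice_derivable k k' t e ->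
  twice_derivable (fun s => g s + k s) (fun s => g' s + k' s) t (d + e).
Proof.
move=> [Dg Dg'] [Dk Dk']; split; last exact: is_deriveD.
near=> s; apply: is_deriveD; [near: s; exact: Dg|near: s; exact: Dk].
Unshelve. all: by end_near. Qed.

Lemma twice_derivableB (g g' k k' : R -> R) (t d e : R) :
  twice_derivable g g' t d -> twice_derivable k k' t e ->
  twice_derivable (fun s => g s - k s) (fun s => g' s - k' s) t (d - e).
Proof.
move=> [Dg Dg'] [Dk Dk']; split; last exact: is_deriveB.
near=> s; apply: is_deriveB; [near: s; exact: Dg|near: s; exact: Dk].
Unshelve. all: by end_near. Qed.

Lemma twice_derivableZ (c : R) (g g' : R -> R) (t d : R) :
  twice_derivable g g' t d ->
  twice_derivable (fun s => c * g s) (fun s => c * g' s) t (c * d).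
Proof.
move=> [Dg Dg']; split; last exact: is_deriveZ.
by apply: filterS Dg => s; exact: is_deriveZ.
Qed.

Lemma twice_derivable_cst (c t : R) :
  twice_derivable (fun=> c) (fun=> 0) t 0.
Proof.
split; last exact: is_derive_cst.
by near=> s; exact: is_derive_cst.
Unshelve. all: by end_near. Qed.

Lemma twice_derivable_affine (a b t : R) :
  twice_derivable (fun s => a + s * b) (fun=> b) t 0.
Proof.
split; last exact: is_derive_cst.
near=> s; have -> : (fun s : R => a + s * b) = cst a + b *: id.
  by apply/funext => x; rewrite !fctE mulrC.
have := is_deriveD (is_derive_cst a s 1)
  (is_deriveZ b (is_derive_id s (1 : R))).
by rewrite add0r [b *: 1]mulr1.
Unshelve. all: by end_near. Qed.

Lemma twice_derivable_comp (F F' q q' : R -> R) (t d e : R) :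
  (\forall s \near t, is_derive (s : R) 1 q (q' s)) ->
  is_derive (t : R) 1 q' d ->
  (\forall s \near t, is_derive (q s : R) 1 F (F' (q s))) ->
  is_derive (q t : R) 1 F' e ->
  twice_derivable (F \o q) (fun s => F' (q s) * q' s) t
    (e * q' t ^+ 2 + F' (q t) * d).
Proof.
move=> Dq Dq' DF DF'; split.
  near=> s; apply: is_derive1_comp; near: s; [exact: DF|exact: Dq].
have Dqt := nbhs_singleton Dq.
have -> : (fun s => F' (q s) * q' s) = (F' \o q) * q' by [].
have D := is_derive1_comp DF' Dqt.
apply: is_derive_eq; rewrite /GRing.scale/=; ring.
Unshelve. all: by end_near. Qed.

Lemma twice_derivable_ln (q q' : R -> R) (t d : R) : 0 < q t ->
  twice_derivable q q' t d ->
  twice_derivable (fun s => ln (q s)) (fun s => (q s)^-1 * q' s) t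
    (d / q t - (q' t / q t) ^+ 2).
Proof.
move=> qt0 [Dq Dq'].
have cq : q s @[s --> t] --> q t.
  by have [/derivable1_continuous] := nbhs_singleton Dq.
have q0 : \forall s \near t, 0 < q s by exact: (cvgr_gt _ cq _ qt0).
have qn : q t != 0 by rewrite gt_eqF.
have DF' : is_derive (q t : R) 1 (fun x : R => x^-1) (- (q t) ^- 2).
  have H := @is_deriveV R id (q t) 1 1 qn (is_derive_id _ _).
  by apply: (@is_derive_eq _ _ _ _ _ _ _ _ H); rewrite /GRing.scale/= mulr1.
have DF : \forall s \near t, is_derive (q s : R) 1 (@ln R) (q s)^-1.
  by apply: filterS q0 => s; exact: is_derive1_ln.
have := @twice_derivable_comp _ (fun x => x^-1) _ _ _ _ _ Dq Dq' DF DF'.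
congr twice_derivable; field => //.
Qed.

Lemma twice_derivable_expR (q q' : R -> R) (t d : R) :
  twice_derivable q q' t d ->
  twice_derivable (fun s => expR (q s)) (fun s => expR (q s) * q' s) t
    (expR (q t) * (q' t ^+ 2 + d)).
Proof.
move=> [Dq Dq']; rewrite mulrDr.
apply: twice_derivable_comp => //.
by near=> s; exact: is_derive_expR.
Unshelve. all: by end_near. Qed.

End SecondDerivative.

(** * Functions of the plane along a line *)

Section Lines.
Context {R : realType}.

Lemma is_derive_line (u : R * R -> R) (p v : R * R) (t : R) :
  derivable u (p + t *: v) v ->
  is_derive (t : R) 1 (fun s => u (p + s *: v)) ('D_v u (p + t *: v)).
Proof.
have E : (fun h : R =>
    h^-1 *: ((u \o shift (p + t *: v)) (h *: v) - u (p + t *: v)))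
  = (fun h : R => h^-1 *: (((fun s => u (p + s *: v)) \o shift t) (h *: 1)
       - u (p + t *: v))).
  apply/funext => s /=; congr (_ *: (u _ - _)).
  by rewrite [s *: 1]mulr1 scalerDl addrCA.
by rewrite /derivable /derive => du; split; rewrite /derivable /derive /= -E.
Qed.

Lemma is_derive_line0 (u : R * R -> R) (p v : R * R) :
  derivable u p v -> is_derive (0 : R) 1 (fun s => u (p + s *: v)) ('D_v u p).
Proof.
have E : p = p + 0 *: v by rewrite scale0r addr0.
by move=> du; rewrite {2}E; apply: is_derive_line; rewrite -E.
Qed.

Lemma twice_derivable_along (u : R * R -> R) (p v : R * R) :
  (\forall s \near (0 : R), derivable u (p + s *: v) v) ->
  derivable ('D_v u) p v ->
  twice_derivable (fun s => u (p + s *: v)) (fun s => 'D_v u (p + s *: v)) 0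
    ('D_v ('D_v u) p).
Proof.
move=> d1 d2; split; last exact: is_derive_line0.
by apply: filterS d1 => s; exact: is_derive_line.
Qed.

Lemma twice_derivable_line (h : R -> R) (x a t : R) :
  (forall y, derivable h y 1) -> (forall y, derivable (derive1 h) y 1) ->
  twice_derivable (fun s => h (x + s * a))
    (fun s => derive1 h (x + s * a) * a) t
    (derive1n 2 h (x + t * a) * a ^+ 2).
Proof.
move=> dh dh'.
have [L L'] := twice_derivable_affine x a t.
have Dh (k : R -> R) y :
    derivable k y 1 -> is_derive (y : R) 1 k (derive1 k y).
  by move=> dk; apply: DeriveDef => //; rewrite derive1E.
rewrite -[X in twice_derivable _ _ _ X]addr0.
rewrite -[X in _ + X](mulr0 (derive1 h (x + t * a))).
apply: (@twice_derivable_comp _ h (derive1 h) (fun s => x + s * a) (fun=> a)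
  _ _ _ L L'); last exact: Dh.
by near=> s; exact: Dh.
Unshelve. all: by end_near. Qed.

Lemma is_derive_line_quotient (u : R * R -> R) (p v : R * R) (b : R) :
  is_derive (0 : R) 1 (fun s => u (p + s *: v)) b ->
  t^-1 * (u (p + t *: v) - u p) @[t --> (0 : R)^'] --> b.
Proof.
move=> [du <-]; move: du; rewrite /derivable /derive.
have -> : (fun h : R => h^-1 *: (((fun s => u (p + s *: v)) \o shift 0) (h *: 1)
    - u (p + 0 *: v))) = (fun t => t^-1 * (u (p + t *: v) - u p)).
  by apply/funext => t; rewrite /= scale0r !addr0 [t *: 1]mulr1.
by [].
Qed.

Lemma open_line (A : set (R * R)) (p v : R * R) : open A -> A p ->
  \forall s \near (0 : R), A (p + s *: v).
Proof.
move=> oA Ap.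
have c : p + s *: v @[s --> (0 : R)] --> p.
  have : p + s *: v @[s --> (0 : R)] --> p + 0 *: v.
    by apply: cvgD; [exact: cvg_cst|apply: cvgZr_tmp; exact: cvg_id].
  by rewrite scale0r addr0.
by apply: c; exact: open_nbhs_nbhs.
Qed.

Lemma Ck_on_twice_derivable_x (A : set (R * R)) (u : R * R -> R) (p : R * R) :
  open A -> A p -> Ck_on 2 A u ->
  twice_derivable (fun s => u (p + s *: dirx R))
    (fun s => 'D_(dirx R) u (p + s *: dirx R)) 0
    ('D_(dirx R) ('D_(dirx R) u) p).
Proof.
move=> oA Ap [_ [du [[_ [dux _]] _]]]; apply: twice_derivable_along.
  by apply: filterS (open_line (dirx R) oA Ap) => s /du[].
have [duxx _] := dux p Ap; exact: duxx.
Qed.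

Lemma Ck_on_twice_derivable_y (A : set (R * R)) (u : R * R -> R) (p : R * R) :
  open A -> A p -> Ck_on 2 A u ->
  twice_derivable (fun s => u (p + s *: diry R))
    (fun s => 'D_(diry R) u (p + s *: diry R)) 0
    ('D_(diry R) ('D_(diry R) u) p).
Proof.
move=> oA Ap [_ [du [_ [_ [duy _]]]]]; apply: twice_derivable_along.
  by apply: filterS (open_line (diry R) oA Ap) => s /du[].
have [_ duyy] := duy p Ap; exact: duyy.
Qed.

End Lines.

(** * Topology of the two domains *)

Section Domains.
Context {R : realType}.

Lemma closed_ge0 (u : R * R -> R) : continuous u -> closed [set p | 0 <= u p].
Proof.
move=> cu; have : closed (u @^-1` [set x | 0 <= x]).
  by apply: preimage_closed => [x _|]; [exact: cu|exact: closed_ge].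
by [].
Qed.

Lemma open_gt0 (u : R * R -> R) : continuous u -> open [set p | 0 < u p].
Proof.
move=> cu; apply: (@open_comp _ _ u [set x | 0 < x]) => [p _|]; first exact: cu.
exact: open_gt.
Qed.

Lemma continuous_height (h : R -> R) : continuous h ->
  continuous (fun p : R * R => p.2 - h p.1).
Proof.
move=> ch p; apply: (@cvgB _ R); first exact: cvg_snd.
by apply: continuous_comp; [exact: cvg_fst|exact: ch].
Qed.

Lemma closure_Omega1 (h : R -> R) (p : R * R) : continuous h ->
  closure (Omega1 h) p -> 0 <= p.2 <= h p.1.
Proof.
move=> ch cp; apply/andP; split.
  suff : [set p : R * R | 0 <= p.2] p by [].
  rewrite (_ : [set _ | _] = closure [set p : R * R | 0 <= p.2]).
    by apply: closureS cp => q [/ltW].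
  by apply/closure_id; apply: closed_ge0 => q; exact: cvg_snd.
suff : [set p : R * R | 0 <= - (p.2 - h p.1)] p by rewrite /= opprB subr_ge0.
rewrite (_ : [set _ | _] = closure [set p : R * R | 0 <= - (p.2 - h p.1)]).
  by apply: closureS cp => q [_ /ltW] /=; rewrite opprB subr_ge0.
apply/closure_id; apply: closed_ge0 => q; apply: (@cvgN _ R).
exact: continuous_height.
Qed.

Lemma closure_Omega2 (h : R -> R) (p : R * R) : continuous h ->
  closure (Omega2 h) p -> h p.1 <= p.2.
Proof.
move=> ch cp.
suff : [set p : R * R | 0 <= p.2 - h p.1] p by rewrite /= subr_ge0.
rewrite (_ : [set _ | _] = closure [set p : R * R | 0 <= p.2 - h p.1]).
  by apply: closureS cp => q /ltW /=; rewrite subr_ge0.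
by apply/closure_id; apply: closed_ge0; exact: continuous_height.
Qed.

Lemma open_Omega1 (h : R -> R) : continuous h -> open (Omega1 h).
Proof.
move=> ch; rewrite (_ : Omega1 h =
   [set p | 0 < p.2] `&` [set p | 0 < - (p.2 - h p.1)]).
  apply: openI; first by apply: open_gt0 => p; exact: cvg_snd.
  by apply: open_gt0 => p; apply: (@cvgN _ R); exact: continuous_height.
by apply/seteqP; split => p /=; rewrite /Omega1 /= opprB subr_gt0.
Qed.

Lemma open_Omega2 (h : R -> R) : continuous h -> open (Omega2 h).
Proof.
move=> ch; rewrite (_ : Omega2 h = [set p | 0 < p.2 - h p.1]).
  exact: open_gt0 (continuous_height ch).
by apply/seteqP; split => p /=; rewrite /Omega2 /= subr_gt0.
Qed.

Lemma upper_bound_closure (T : topologicalType) (A : set T) (u : T -> R) (M : R) :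
  {within closure A, continuous u} -> (forall p, A p -> u p <= M) ->
  forall p, closure A p -> u p <= M.
Proof.
move=> /subspace_continuousP cu uM p clp; rewrite leNgt; apply/negP => Mu.
have := cvgr_gt _ (cu p clp) _ Mu; rewrite near_withinE => nearM.
have [q [Aq]] := clp _ (nearM _).
by move=> /(_ (subset_closure Aq)); rewrite ltNge uM.
Qed.

End Domains.

(** * The barrier *)

Section Barrier.
Context {R : realType}.

(** Strict superharmonicity at [p], with the two second derivatives taken along
    the coordinate lines through [p], which is all that the second derivative
    test consumes. *)
Definition line_superharmonic (B : R * R -> R) (p : R * R) : Prop :=
  exists gx dx gy dy,
    [/\ twice_derivable (fun s => B (p + s *: dirx R)) gx 0 dx,
        twice_derivable (fun s => B (p + s *: diry R)) gy 0 dy & dx + dy < 0].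

(** A strict supersolution of the homogeneous transmission problem that is
    infinite at infinity; [tb_flux] says that its weighted flux drops strictly
    across the interface. *)
Record transmission_barrier (eps1 eps2 : R) (h : R -> R) (B1 B2 : R * R -> R)
    : Prop := TransmissionBarrier {
  tb_ge0_bottom : forall p, @Gamma0 R p -> 0 <= B1 p;
  tb_coercive_inner : forall M, exists X, forall p,
    closure (Omega1 h) p -> X < `|p| -> M < B1 p;
  tb_coercive_outer : forall M, exists X, forall p,
    closure (Omega2 h) p -> X < `|p| -> M < B2 p;
  tb_continuous_inner : {within closure (Omega1 h), continuous B1};
  tb_continuous_outer : {within closure (Omega2 h), continuous B2};
  tb_superharmonic_inner : forall p, Omega1 h p -> line_superharmonic B1 p;
  tb_superharmonic_outer : forall p, Omega2 h p -> line_superharmonic B2 p;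
  tb_interface : forall p, GammaI h p -> B1 p = B2 p;
  tb_flux : forall p, GammaI h p -> exists b1 b2,
    [/\ is_derive (0 : R) 1 (fun s => B1 (p + s *: normal h p)) b1,
        is_derive (0 : R) 1 (fun s => B2 (p + s *: normal h p)) b2
      & eps2 * b2 < eps1 * b1]
}.

(** Twice the logarithm of the distance to (0, -1), a pole at distance at least
    1 from both domains. *)
Definition log_potential (p : R * R) : R := ln (p.1 ^+ 2 + (p.2 + 1) ^+ 2).

(** A function of the vertical distance to the graph of [h], increasing upwards
    and bounded on the strip below the graph when [h] is.  For [h = 0] and
    [lam = 1] it is [- exp (- y)], so it serves both domains. *)
Definition layer (lam : R) (h : R -> R) (p : R * R) : R :=
  - expR (lam * (h p.1 - p.2)).

Definition outer_barrier (C : R) (p : R * R) : R :=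
  C + log_potential p + layer 1 (cst 0) p.

Definition inner_barrier (C A lam : R) (h : R -> R) (p : R * R) : R :=
  outer_barrier C p + A * (1 + layer lam h p).

Lemma pole_dist_ge1 (p : R * R) : 0 <= p.2 -> 1 <= p.1 ^+ 2 + (p.2 + 1) ^+ 2.
Proof. by move=> p0; nra. Qed.

Lemma log_potential_line (p v : R * R) : 0 <= p.2 ->
  exists g', g' 0 =
    2 * (p.1 * v.1 + (p.2 + 1) * v.2) / (p.1 ^+ 2 + (p.2 + 1) ^+ 2)
  /\ twice_derivable (fun s => log_potential (p + s *: v)) g' 0
   (2 * (v.1 ^+ 2 + v.2 ^+ 2) / (p.1 ^+ 2 + (p.2 + 1) ^+ 2)
    - (2 * (p.1 * v.1 + (p.2 + 1) * v.2) / (p.1 ^+ 2 + (p.2 + 1) ^+ 2)) ^+ 2).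
Proof.
move=> p0; have r1 := pole_dist_ge1 p0.
pose q s := (p.1 + s * v.1) ^+ 2 + (p.2 + s * v.2 + 1) ^+ 2.
pose q' s := 2 * (p.1 + s * v.1) * v.1 + 2 * (p.2 + 1 + s * v.2) * v.2.
have q0 : q 0 = p.1 ^+ 2 + (p.2 + 1) ^+ 2 by rewrite /q !mul0r !addr0.
have q'0 : q' 0 = 2 * (p.1 * v.1 + (p.2 + 1) * v.2).
  by rewrite /q' !mul0r !addr0; ring.
have Dsq (x a : R) : twice_derivable (fun s : R => (x + s * a) ^+ 2)
    (fun s => 2 * (x + s * a) * a) 0 (2 * a ^+ 2).
  have [L L'] := twice_derivable_affine x a 0; split.
    near=> s; have Ls : is_derive (s : R) 1 (fun s => x + s * a) a by near: s.
    exact: (is_deriveX 2 Ls).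
  have [D _] := twice_derivableZ (2 * a) (twice_derivable_affine x a 0).
  have := nbhs_singleton D.
  rewrite expr2 mulrA; congr is_derive; apply/funext => s; ring.
have Dq : twice_derivable q q' 0 (2 * (v.1 ^+ 2 + v.2 ^+ 2)).
  have := twice_derivableD (Dsq p.1 v.1) (Dsq (p.2 + 1) v.2).
  rewrite -mulrDr; congr twice_derivable; apply/funext => s; rewrite /q; ring.
exists (fun s => (q s)^-1 * q' s); split.
  by rewrite -q0 -q'0 mulrC.
rewrite -q0 -q'0; have q_gt0 : 0 < q 0 by rewrite q0 (lt_le_trans ltr01).
exact: (twice_derivable_ln q_gt0 Dq).
Unshelve. all: by end_near. Qed.

Lemma layer_line (lam : R) (h : R -> R) (p v : R * R) :
  (forall y, derivable h y 1) -> (forall y, derivable (derive1 h) y 1) ->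
  exists g', g' 0 =
    expR (lam * (h p.1 - p.2)) * (lam * (v.2 - derive1 h p.1 * v.1))
  /\ twice_derivable (fun s => layer lam h (p + s *: v)) g' 0
   (- (expR (lam * (h p.1 - p.2)) * (lam ^+ 2 * (derive1 h p.1 * v.1 - v.2) ^+ 2
       + lam * (derive1n 2 h p.1 * v.1 ^+ 2)))).
Proof.
move=> dh dh'.
have := twice_derivableZ lam (twice_derivableB
   (twice_derivable_line p.1 v.1 0 dh dh') (twice_derivable_affine p.2 v.2 0)).
move=> /twice_derivable_expR/(twice_derivableZ (-1)).
rewrite mul0r !addr0 subr0 mul0r addr0 exprMn mulN1r => D.
eexists; split; last first.
  move: D; congr twice_derivable; apply/funext => s.
  by rewrite /layer mulN1r.
by rewrite /= !mul0r !addr0; ring.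
Qed.

(** Writing [E] for the exponential, the Laplacian is
    [- E * (lam^2 * (1 + h'^2) + lam * h'')], and [lam^2] dominates
    [lam * |h''|]. *)
Lemma layer_superharmonic (lam : R) (h : R -> R) (p : R * R) :
  0 < lam -> `|derive1n 2 h p.1| < lam ->
  (forall y, derivable h y 1) -> (forall y, derivable (derive1 h) y 1) ->
  line_superharmonic (layer lam h) p.
Proof.
move=> lam0 hlam dh dh'.
have [gx [_ Dx]] := layer_line lam p (dirx R) dh dh'.
have [gy [_ Dy]] := layer_line lam p (diry R) dh dh'.
do 4 eexists; split; [exact: Dx|exact: Dy|].
rewrite -opprD oppr_lt0 -mulrDr mulr_gt0 ?expR_gt0//.
move: (derive1n 2 h p.1) (derive1 h p.1) hlam => a b.
rewrite ltr_norml /= => /andP[h1 _].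
have : 0 < lam * (lam + a) by rewrite mulr_gt0//; lra.
by have := mulr_ge0 (sqr_ge0 lam) (sqr_ge0 b); lra.
Qed.

Lemma derivable_zero (y : R) : derivable (cst 0 : R -> R) y 1.
Proof. exact: derivable_cst. Qed.

Lemma derive1_zero : derive1 (cst 0 : R -> R) = cst 0.
Proof. by apply/funext => x; rewrite derive1_cst. Qed.

Lemma outer_barrier_superharmonic (C : R) (p : R * R) : 0 <= p.2 ->
  line_superharmonic (outer_barrier C) p.
Proof.
move=> p0; have r1 := pole_dist_ge1 p0.
have [|||gx [dx [gy [dy [Dx Dy dxy]]]]] :=
   @layer_superharmonic 1 (cst 0) p ltr01.
- by rewrite derive1nS derive1n1 derive1_zero derive1_zero normr0.
- exact: derivable_zero.
- by rewrite derive1_zero; exact: derivable_zero.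
have [lx [_ Lx]] := log_potential_line (dirx R) p0.
have [ly [_ Ly]] := log_potential_line (diry R) p0.
do 4 eexists; split.
- exact: twice_derivableD (twice_derivableD (twice_derivable_cst C 0) Lx) Dx.
- exact: twice_derivableD (twice_derivableD (twice_derivable_cst C 0) Ly) Dy.
rewrite !add0r addrACA /=; set l := (X in X + _).
suff -> : l = 0 by rewrite add0r.
by rewrite /l /=; field; rewrite gt_eqF// (lt_le_trans ltr01).
Qed.

Lemma inner_barrier_superharmonic (C A lam : R) (h : R -> R) (p : R * R) :
  0 <= p.2 -> 0 < A ->
  0 < lam -> `|derive1n 2 h p.1| < lam ->
  (forall y, derivable h y 1) -> (forall y, derivable (derive1 h) y 1) ->
  line_superharmonic (inner_barrier C A lam h) p.
Proof.
move=> p0 A0 lam0 hlam dh dh'.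
have [ox [ex [oy [ey [Ox Oy oxy]]]]] := outer_barrier_superharmonic C p0.
have [gx [dx [gy [dy [Dx Dy dxy]]]]] := layer_superharmonic lam0 hlam dh dh'.
do 4 eexists; split.
- exact: twice_derivableD Ox (twice_derivableZ _
    (twice_derivableD (twice_derivable_cst 1 0) Dx)).
- exact: twice_derivableD Oy (twice_derivableZ _
    (twice_derivableD (twice_derivable_cst 1 0) Dy)).
rewrite !add0r addrACA -mulrDr.
by have := @nmulr_llt0 _ _ A dxy; rewrite mulrC; nra.
Qed.

Lemma continuous_log_potential (p : R * R) : 0 <= p.2 ->
  {for p, continuous log_potential}.
Proof.
move=> p0; apply: (@continuous_comp _ R R
  (fun p : R * R => p.1 ^+ 2 + (p.2 + 1) ^+ 2) (@ln R)).
  apply: (@cvgD _ R).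
    apply: (@continuous_comp _ _ _ fst (fun x : R => x ^+ 2)).
      exact: cvg_fst.
    exact: exprn_continuous.
  apply: (@continuous_comp _ _ _ (fun p : R * R => p.2 + 1)
    (fun x : R => x ^+ 2)).
    by apply: (@cvgD _ R); [exact: cvg_snd|exact: cvg_cst].
  exact: exprn_continuous.
by apply: continuous_ln; rewrite (lt_le_trans ltr01)// pole_dist_ge1.
Qed.

Lemma continuous_layer (lam : R) (h : R -> R) : continuous h ->
  continuous (layer lam h).
Proof.
move=> ch p; apply: (@cvgN _ R).
apply: (@continuous_comp _ _ _ (fun p : R * R => lam * (h p.1 - p.2)) expR).
  apply: (@cvgM R); first exact: cvg_cst.
  apply: (@cvgB _ R); last exact: cvg_snd.
  by apply: continuous_comp; [exact: cvg_fst|exact: ch].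
exact: continuous_expR.
Qed.

Lemma continuous_outer_barrier (C : R) (p : R * R) : 0 <= p.2 ->
  {for p, continuous (outer_barrier C)}.
Proof.
move=> p0; apply: (@cvgD _ R).
  by apply: (@cvgD _ R); [exact: cvg_cst|exact: continuous_log_potential].
by apply: continuous_layer => x; exact: cvg_cst.
Qed.

Lemma continuous_inner_barrier (C A lam : R) (h : R -> R) (p : R * R) :
  continuous h -> 0 <= p.2 ->
  {for p, continuous (inner_barrier C A lam h)}.
Proof.
move=> ch p0; apply: (@cvgD _ R); first exact: continuous_outer_barrier.
apply: (@cvgM R); first exact: cvg_cst.
by apply: (@cvgD _ R); [exact: cvg_cst|exact: continuous_layer].
Qed.

Lemma log_potential_ge0 (p : R * R) : 0 <= p.2 -> 0 <= log_potential p.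
Proof. by move=> p0; rewrite ln_ge0// pole_dist_ge1. Qed.

(** Above the bottom line the distance of [p] to the pole is at least 1 and at
    least [`|p|], hence its square is at least [`|p|]. *)
Lemma log_potential_coercive (M : R) (p : R * R) : 0 <= p.2 ->
  expR M < `|p| -> M < log_potential p.
Proof.
move=> p0 Mp; rewrite -ltr_expR lnK; last first.
  by rewrite posrE (lt_le_trans ltr01)// pole_dist_ge1.
apply: lt_le_trans Mp _; rewrite prod_normE/= ge_max; apply/andP; split.
  have : `|p.1| ^+ 2 = p.1 ^+ 2 by rewrite real_normK// num_real.
  by have := normr_ge0 p.1; nra.
by rewrite ger0_norm//; nra.
Qed.

Lemma outer_barrier_ge (C : R) (p : R * R) : 0 <= p.2 ->
  C - 1 + log_potential p <= outer_barrier C p.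
Proof.
move=> p0; have : expR (1 * (0 - p.2)) <= 1.
  by rewrite -[X in _ <= X]expR0 ler_expR mul1r sub0r oppr_le0.
by rewrite /outer_barrier /layer /=; lra.
Qed.

Lemma inner_barrier_ge (C A lam H : R) (h : R -> R) (p : R * R) :
  0 <= A -> 0 <= lam -> h p.1 <= H -> 0 <= p.2 ->
  C - 1 - A * expR (lam * H) + log_potential p <= inner_barrier C A lam h p.
Proof.
move=> A0 lam0 hH p0; have := outer_barrier_ge C p0.
have e : expR (lam * (h p.1 - p.2)) <= expR (lam * H).
  rewrite ler_expR ler_wpM2l// lerBlDr (le_trans hH)// lerDl//.
by have := ler_wpM2l A0 e; rewrite /inner_barrier /layer; lra.
Qed.

Lemma barrier_interface (C A lam : R) (h : R -> R) (p : R * R) :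
  GammaI h p -> inner_barrier C A lam h p = outer_barrier C p.
Proof.
move=> pI; rewrite /inner_barrier /layer pI subrr mulr0 expR0 subrr mulr0.
by rewrite addr0.
Qed.

(** The slope along the normal of the vertical distance to the graph is
    [sqrt (1 + h'^2)]. *)
Lemma normal_slope_ge1 (h : R -> R) (p : R * R) :
  1 <= (normal h p).2 - derive1 h p.1 * (normal h p).1.
Proof.
have d0 := sqr_ge0 (derive1 h p.1).
have s1 : 1 <= Num.sqrt (1 + derive1 h p.1 ^+ 2).
  by rewrite -[X in X <= _]sqrtr1 ler_sqrt ?lerDl// addr_ge0.
have s2 : Num.sqrt (1 + derive1 h p.1 ^+ 2) ^+ 2 = 1 + derive1 h p.1 ^+ 2.
  by rewrite sqr_sqrtr// addr_ge0.
rewrite /normal /= /GRing.scale /=; move: s1 s2; set s := Num.sqrt _ => s1 s2.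
have -> : s^-1 * 1 - derive1 h p.1 * (s^-1 * - derive1 h p.1) =
   s^-1 * (1 + derive1 h p.1 ^+ 2) by ring.
by rewrite -s2 expr2 mulKf// gt_eqF// (lt_le_trans ltr01).
Qed.

(** The bound is uniform along the whole interface, which lets one constant [A]
    produce the flux jump everywhere.  The logarithm contributes at most 4 and
    the exponential at most 1. *)
Lemma outer_barrier_normal (C : R) (h : R -> R) (p : R * R) : 0 <= p.2 ->
  exists2 b, `|b| <= 5 &
    is_derive (0 : R) 1 (fun s => outer_barrier C (p + s *: normal h p)) b.
Proof.
move=> p0; have r1 := pole_dist_ge1 p0.
have [l [l0 [Dl _]]] := log_potential_line (normal h p) p0.
have [||g [g0 [Dg _]]] := @layer_line 1 (cst 0) p (normal h p).
- exact: derivable_zero.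
- by rewrite derive1_zero; exact: derivable_zero.
have D := is_deriveD (is_deriveD (is_derive_cst C (0 : R) (1 : R))
  (nbhs_singleton Dl)) (nbhs_singleton Dg).
exists (l 0 + g 0); last by move: D; rewrite add0r.
have n1 := normal_unit h p.
move: (normal h p) n1 l0 g0 => [a b] /= n1 -> ->; rewrite derive1_zero.
have [a1 b1] : `|a| <= 1 /\ `|b| <= 1.
  by rewrite !ler_norml; split; apply/andP; split; nra.
have e1 : expR (1 * (cst 0 p.1 - p.2)) <= 1.
  by rewrite -[X in _ <= X]expR0 ler_expR mul1r sub0r oppr_le0.
have -> : (5 : R) = 4 + 1 by ring.
rewrite mul0r subr0 (le_trans (ler_normD _ _))// lerD//; last first.
  rewrite normrM (ger0_norm (expR_ge0 _)) mulr_ile1 ?expR_ge0//.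
  by rewrite mul1r.
move: r1; set r := _ + _ => r1.
have r0 : 0 < r by rewrite (lt_le_trans ltr01).
rewrite normrM normfV (gtr0_norm r0) ler_pdivrMr// normrM ger0_norm//.
have x1 : `|p.1| <= r.
  have : `|p.1| ^+ 2 = p.1 ^+ 2 by rewrite real_normK// num_real.
  by rewrite /r; have := normr_ge0 p.1; nra.
have y1 : `|p.2 + 1| <= r by rewrite ger0_norm ?addr_ge0// /r; nra.
have xa : `|p.1 * a| <= r by rewrite normrM -[r]mulr1 ler_pM.
have yb : `|(p.2 + 1) * b| <= r by rewrite normrM -[r]mulr1 ler_pM.
by have := ler_normD (p.1 * a) ((p.2 + 1) * b); lra.
Qed.

Lemma barrier_flux (eps1 eps2 C A lam : R) (h : R -> R) (p : R * R) :
  (forall y, derivable h y 1) -> (forall y, derivable (derive1 h) y 1) ->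
  0 < eps1 -> 0 < eps2 -> 1 <= lam -> 5 * (eps1 + eps2) < eps1 * A ->
  0 <= p.2 -> GammaI h p ->
  exists b1 b2,
    [/\ is_derive (0 : R) 1
          (fun s => inner_barrier C A lam h (p + s *: normal h p)) b1,
        is_derive (0 : R) 1 (fun s => outer_barrier C (p + s *: normal h p)) b2
      & eps2 * b2 < eps1 * b1].
Proof.
move=> dh dh' e1 e2 lam1 hA p0 pI.
have [b b5 Db] := outer_barrier_normal C h p0.
have [g [g0 [Dg _]]] := layer_line lam p (normal h p) dh dh'.
have D := is_deriveD Db (is_deriveZ A (is_deriveD
  (is_derive_cst (1 : R) (0 : R) (1 : R)) (nbhs_singleton Dg))).
exists (b + A * g 0), b; split => //; first by move: D; rewrite add0r.
rewrite g0 pI subrr mulr0 expR0 mul1r.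
have := normal_slope_ge1 h p; move: (_ - _) => s s1.
have ls : 1 <= lam * s by rewrite -[X in X <= _]mulr1 ler_pM.
move: b5; rewrite ler_norml => /andP[b5 b5'].
have A0 : 0 < eps1 * A by apply: lt_trans hA; lra.
have : eps1 * A <= eps1 * A * (lam * s) by rewrite ler_peMr// ltW.
nra.
Qed.

Lemma barrier_exists (eps1 eps2 : R) (h : R -> R) (H K : R) :
  0 < eps1 -> 0 < eps2 -> (forall x, 0 < h x) ->
  (forall y, derivable h y 1) -> (forall y, derivable (derive1 h) y 1) ->
  (forall x, h x <= H) -> (forall x, `|derive1n 2 h x| <= K) ->
  exists B1 B2, transmission_barrier eps1 eps2 h B1 B2.
Proof.
move=> e1 e2 h0 dh dh' hH hK.
have ch : continuous h by move=> x; exact: derivable1_continuous.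
have K0 : 0 <= K by apply: le_trans (hK 0).
(* [5] bounds the normal derivative of the outer barrier, so that this [A] makes
   [eps1 * A] larger than [5 * (eps1 + eps2)]; [C] below compensates the lower
   bounds [- 1] and [- A * exp (lam * H)] of the two layers. *)
pose lam := 1 + K; pose A := 5 * (1 + eps2 / eps1) + 1.
have lam1 : 1 <= lam by rewrite lerDl.
have lam0 : 0 < lam by apply: lt_le_trans lam1.
have A0 : 0 < A.
  by rewrite ltr_wpDl// mulr_ge0// addr_ge0// divr_ge0// ltW.
have hA : 5 * (eps1 + eps2) < eps1 * A.
  have -> : eps1 * A = 5 * (eps1 + eps2) + eps1.
    by rewrite /A; field; rewrite gt_eqF.
  by rewrite ltrDl.
pose C := 1 + A * expR (lam * H).
have Hlam x : `|derive1n 2 h x| < lam.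
  by rewrite (le_lt_trans (hK x))// /lam ltrDr.
have cl1 p : closure (Omega1 h) p -> 0 <= p.2.
  by move/(closure_Omega1 ch)/andP => [].
have cl2 p : closure (Omega2 h) p -> 0 <= p.2.
  by move/(closure_Omega2 ch); apply: le_trans; exact: ltW.
have ge1 p : 0 <= p.2 -> log_potential p <= inner_barrier C A lam h p.
  move=> p0; have := inner_barrier_ge C (ltW A0) (ltW lam0) (hH p.1) p0.
  by rewrite /C; lra.
have ge2 p : 0 <= p.2 -> log_potential p <= outer_barrier C p.
  move=> p0; apply: le_trans (outer_barrier_ge C p0).
  by rewrite lerDr /C addrAC subrr add0r mulr_ge0 ?expR_ge0// ltW.
exists (inner_barrier C A lam h), (outer_barrier C); split.
- move=> p pG; have p0 : 0 <= p.2 by rewrite pG.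
  exact: le_trans (log_potential_ge0 p0) (ge1 _ p0).
- move=> M; exists (expR M) => p /cl1 p0 pX.
  exact: lt_le_trans (log_potential_coercive p0 pX) (ge1 _ p0).
- move=> M; exists (expR M) => p /cl2 p0 pX.
  exact: lt_le_trans (log_potential_coercive p0 pX) (ge2 _ p0).
- apply: continuous_in_subspaceT => p; rewrite inE => /cl1.
  exact: continuous_inner_barrier.
- apply: continuous_in_subspaceT => p; rewrite inE => /cl2.
  exact: continuous_outer_barrier.
- by move=> p [/ltW p0 _]; exact: inner_barrier_superharmonic.
- move=> p /= hp; apply: outer_barrier_superharmonic.
  by rewrite (le_trans (ltW (h0 p.1)))// ltW.
- exact: barrier_interface.
- by move=> p pI; apply: barrier_flux => //; rewrite pI ltW.
Qed.

End Barrier.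

(** * Positive maxima *)

Section Maxima.
Context {R : realType}.

Lemma coercive_max (A : set (R * R)) (u : R * R -> R) (X : R) (q : R * R) :
  closed A -> {within A, continuous u} ->
  (forall p, A p -> X < `|p| -> u p <= 0) -> A q -> 0 < u q ->
  exists p, [/\ A p, 0 < u p & forall r, A r -> u r <= u p].
Proof.
move=> cA cu uX Aq uq.
pose K := (`[- X, X] `*` `[- X, X]) `&` A.
have KE p : A p -> `|p| <= X -> K p.
  move=> Ap; rewrite prod_normE/= ge_max !ler_norml => /andP[p1 p2].
  by split => //; split; rewrite /= in_itv.
have Kq : K q.
  by apply: KE => //; rewrite leNgt; apply/negP => /(uX _ Aq); rewrite leNgt uq.
have cK : compact K.
  by apply: compact_closedI => //; apply: compact_setX; exact: segment_compact.
have cuK : {within K, continuous u}.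
  by apply: continuous_subspaceW cu => p [].
have [p] := compact_EVT_max (ex_intro _ q Kq) cK cuK.
rewrite inE => -[_ Ap] pmax; have up : 0 < u p.
  by rewrite (lt_le_trans uq)// pmax// inE.
exists p; split => // r Ar; have [rX|rX] := leP `|r| X.
  by apply: pmax; rewrite inE; exact: KE.
exact: le_trans (uX _ Ar rX) (ltW up).
Qed.

(** The larger of the two maxima: a pair of functions that agree on the
    interface is treated as one function, without gluing them. *)
Lemma coercive_max2 (A1 A2 : set (R * R)) (u1 u2 : R * R -> R) (X1 X2 : R) :
  closed A1 -> closed A2 ->
  {within A1, continuous u1} -> {within A2, continuous u2} ->
  (forall p, A1 p -> X1 < `|p| -> u1 p <= 0) ->
  (forall p, A2 p -> X2 < `|p| -> u2 p <= 0) ->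
  (exists2 q, A1 q & 0 < u1 q) \/ (exists2 q, A2 q & 0 < u2 q) ->
  exists m, [/\ 0 < m, forall r, A1 r -> u1 r <= m, forall r, A2 r -> u2 r <= m
    & (exists2 p, A1 p & u1 p = m) \/ (exists2 p, A2 p & u2 p = m)].
Proof.
move=> cA1 cA2 cu1 cu2 uX1 uX2 pos.
have [[q1 Aq1 uq1]|N1] := pselect (exists2 q, A1 q & 0 < u1 q); last first.
  case: pos => [//|[q2 Aq2 uq2]].
  have [p2 [Ap2 up2 max2]] := coercive_max cA2 cu2 uX2 Aq2 uq2.
  exists (u2 p2); split => //; last by right; exists p2.
  move=> r Ar; apply: ltW; apply: le_lt_trans up2; rewrite leNgt.
  by apply/negP => ur; apply: N1; exists r.
have [p1 [Ap1 up1 max1]] := coercive_max cA1 cu1 uX1 Aq1 uq1.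
have [[q2 Aq2 uq2]|N2] := pselect (exists2 q, A2 q & u1 p1 < u2 q); last first.
  exists (u1 p1); split => //; last by left; exists p1.
  by move=> r Ar; rewrite leNgt; apply/negP => ur; apply: N2; exists r.
have [p2 [Ap2 up2 max2]] := coercive_max cA2 cu2 uX2 Aq2 (lt_trans up1 uq2).
exists (u2 p2); split => //; last by right; exists p2.
move=> r Ar; apply: le_trans (max1 r Ar) _; apply: ltW.
exact: lt_le_trans uq2 (max2 _ Aq2).
Qed.

End Maxima.

(** * Comparison of two solutions *)

Section Comparison.
Context {R : realType}.

Definition perturbed (phi psi B : R * R -> R) (delta : R) (p : R * R) : R :=
  phi p - psi p - delta * B p.

Lemma perturbed_continuous (A : set (R * R)) (phi psi B : R * R -> R)
    (delta : R) :
  {within A, continuous phi} -> {within A, continuous psi} ->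
  {within A, continuous B} ->
  {within A, continuous (perturbed phi psi B delta)}.
Proof.
move=> cphi cpsi cB p; apply: (@cvgB _ R).
  by apply: (@cvgB _ R); [exact: cphi|exact: cpsi].
by apply: (@cvgM R); [exact: cvg_cst|exact: cB].
Qed.

Lemma perturbed_coercive (A : set (R * R)) (phi psi B : R * R -> R)
    (delta : R) :
  0 < delta ->
  BC2_closure A phi -> BC2_closure A psi ->
  (forall M, exists X, forall p, closure A p -> X < `|p| -> M < B p) ->
  exists X, forall p, closure A p -> X < `|p| ->
    perturbed phi psi B delta p <= 0.
Proof.
move=> d0 [_ /ex_strict_bound_gt0[M1 _ bphi] cphi].
move=> [_ /ex_strict_bound_gt0[M2 _ bpsi] cpsi] cB.
have le1 : forall p, closure A p -> phi p <= M1.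
  apply: upper_bound_closure cphi _ => p /bphi /= /ltW.
  exact: le_trans (ler_norm _).
have le2 : forall p, closure A p -> - psi p <= M2.
  apply: (@upper_bound_closure _ _ _ (fun p => - psi p)).
    by move=> p; apply: (@cvgN _ R); exact: cpsi.
  by move=> p /bpsi /= /ltW; apply: le_trans; rewrite -normrN ler_norm.
have [X BX] := cB ((M1 + M2) / delta).
exists X => p clp /(BX _ clp); rewrite ltr_pdivrMr// mulrC => Bp.
by rewrite /perturbed; have := le1 p clp; have := le2 p clp; lra.
Qed.

(** The two coordinate second derivatives of [perturbed phi psi B delta] at [p]
    add up to [- delta] times a negative number, while each of them would be
    nonpositive at a maximum. *)
Lemma no_interior_max (A : set (R * R)) (phi psi B : R * R -> R) (delta : R)
    (p : R * R) :
  open A -> A p -> Ck_on 2 A phi -> Ck_on 2 A psi ->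
  laplacian phi p = laplacian psi p -> 0 < delta -> line_superharmonic B p ->
  ~ (forall q, A q ->
       perturbed phi psi B delta q <= perturbed phi psi B delta p).
Proof.
move=> oA Ap Cphi Cpsi E d0 [bx [dx [by_ [dy [Bx By Bxy]]]]] pmax.
have near_max v : \forall s \near (0 : R),
    perturbed phi psi B delta (p + s *: v)
      <= perturbed phi psi B delta (p + 0 *: v).
  rewrite scale0r addr0.
  by apply: filterS (open_line v oA Ap) => s; exact: pmax.
have := second_derivative_at_max (twice_derivableB (twice_derivableB
  (Ck_on_twice_derivable_x oA Ap Cphi) (Ck_on_twice_derivable_x oA Ap Cpsi))
  (twice_derivableZ delta Bx)) (near_max _).
have := second_derivative_at_max (twice_derivableB (twice_derivableB
  (Ck_on_twice_derivable_y oA Ap Cphi) (Ck_on_twice_derivable_y oA Ap Cpsi))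
  (twice_derivableZ delta By)) (near_max _).
have := mulr_gt0 d0 (_ : 0 < - (dx + dy)); rewrite oppr_gt0 => /(_ Bxy).
move: E; rewrite /laplacian.
move: ('D_(dirx R) ('D_(dirx R) phi) p) ('D_(diry R) ('D_(diry R) phi) p).
move: ('D_(dirx R) ('D_(dirx R) psi) p) ('D_(diry R) ('D_(diry R) psi) p).
by move=> psixx psiyy phixx phiyy; lra.
Qed.

Lemma perturbed_quotient_cvg {F : set_system R} {FF : Filter F}
    (phi psi B : R * R -> R) (delta : R) (p v : R * R) (d e b : R) :
  t^-1 * (phi (p + t *: v) - phi p) @[t --> F] --> d ->
  t^-1 * (psi (p + t *: v) - psi p) @[t --> F] --> e ->
  t^-1 * (B (p + t *: v) - B p) @[t --> F] --> b ->
  t^-1 * (perturbed phi psi B delta (p + t *: v) - perturbed phi psi B delta p)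
    @[t --> F] --> d - e - delta * b.
Proof.
move=> Dphi Dpsi DB.
have -> : (fun t => t^-1 * (perturbed phi psi B delta (p + t *: v)
      - perturbed phi psi B delta p)) =
  (fun t => t^-1 * (phi (p + t *: v) - phi p)
    - t^-1 * (psi (p + t *: v) - psi p)
    - delta * (t^-1 * (B (p + t *: v) - B p))).
  by apply/funext => t; rewrite /perturbed; ring.
apply: (@cvgB _ R); first exact: (@cvgB _ R).
by apply: (@cvgM R); first exact: cvg_cst.
Qed.

(** At a common maximum the normal difference quotients are nonnegative from the
    side of [Omega1 h] and nonpositive from the side of [Omega2 h].  After
    multiplication by the weights, the terms of [phi] and [psi] cancel and leave
    [eps1 * b1 <= eps2 * b2]. *)
Lemma no_interface_max (eps1 eps2 delta : R) (h : R -> R)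
    (phi1 phi2 psi1 psi2 B1 B2 : R * R -> R) (p : R * R)
    (d1 d2 e1 e2 b1 b2 : R) :
  0 < eps1 -> 0 < eps2 -> 0 < delta -> derivable h p.1 1 -> 0 < h p.1 ->
  GammaI h p ->
  derivative_from_minus phi1 p (normal h p) d1 ->
  derivative_from_plus phi2 p (normal h p) d2 -> eps1 * d1 = eps2 * d2 ->
  derivative_from_minus psi1 p (normal h p) e1 ->
  derivative_from_plus psi2 p (normal h p) e2 -> eps1 * e1 = eps2 * e2 ->
  is_derive (0 : R) 1 (fun s => B1 (p + s *: normal h p)) b1 ->
  is_derive (0 : R) 1 (fun s => B2 (p + s *: normal h p)) b2 ->
  eps2 * b2 < eps1 * b1 ->
  (forall q, Omega1 h q -> perturbed phi1 psi1 B1 delta q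
    <= perturbed phi1 psi1 B1 delta p) ->
  ~ (forall q, Omega2 h q -> perturbed phi2 psi2 B2 delta q
    <= perturbed phi2 psi2 B2 delta p).
Proof.
move=> eps10 eps20 d0 dh h0 pI Dphi1 Dphi2 Ephi Dpsi1 Dpsi2 Epsi.
move=> DB1 DB2 Eb max1 max2.
have s1 : 0 <= d1 - e1 - delta * b1.
  have C := perturbed_quotient_cvg (delta := delta) Dphi1 Dpsi1
    (cvg_dnbhs_at_left (is_derive_line_quotient DB1)).
  apply: (cvgr_to_ge (C _)).
  have t0 : \forall t \near (0 : R)^'-, t < 0 by exact: nbhs_left_lt.
  near=> t; rewrite nmulr_rge0 ?invr_lt0 ?subr_le0; last by near: t.
  by apply: max1; near: t; exact: normal_from_Omega1.
have s2 : d2 - e2 - delta * b2 <= 0.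
  have C := perturbed_quotient_cvg (delta := delta) Dphi2 Dpsi2
    (cvg_dnbhs_at_right (is_derive_line_quotient DB2)).
  apply: (cvgr_to_le (C _)).
  have t0 : \forall t \near (0 : R)^'+, 0 < t by exact: nbhs_right_gt.
  near=> t; rewrite pmulr_rle0 ?invr_gt0 ?subr_le0; last by near: t.
  by apply: max2; near: t; exact: normal_out_of_Omega1.
have := mulr_ge0 (ltW eps10) s1.
have : eps2 * (d2 - e2 - delta * b2) <= 0 by rewrite pmulr_rle0.
have : delta * (eps2 * b2) < delta * (eps1 * b1) by rewrite ltr_pM2l.
nra.
Unshelve. all: by end_near. Qed.

Lemma transmission_perturbed_le0 (eps1 eps2 delta : R) (f h : R -> R)
    (phi1 phi2 psi1 psi2 B1 B2 : R * R -> R) :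
  0 < eps1 -> 0 < eps2 -> 0 < delta ->
  (forall x, 0 < h x) -> (forall x, derivable h x 1) ->
  transmission_barrier eps1 eps2 h B1 B2 ->
  transmission_solution eps1 eps2 f h phi1 phi2 ->
  transmission_solution eps1 eps2 f h psi1 psi2 ->
  (forall p, closure (Omega1 h) p -> perturbed phi1 psi1 B1 delta p <= 0) /\
  (forall p, closure (Omega2 h) p -> perturbed phi2 psi2 B2 delta p <= 0).
Proof.
move=> e10 e20 d0 h0 dh tb sphi spsi.
have ch : continuous h by move=> x; exact: derivable1_continuous.
have [C1phi _ cphi1] := ts_space1 sphi; have [C1psi _ cpsi1] := ts_space1 spsi.
have [C2phi _ cphi2] := ts_space2 sphi; have [C2psi _ cpsi2] := ts_space2 spsi.
have [X1 uX1] := perturbed_coercive d0 (ts_space1 sphi) (ts_space1 spsi)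
  (tb_coercive_inner tb).
have [X2 uX2] := perturbed_coercive d0 (ts_space2 sphi) (ts_space2 spsi)
  (tb_coercive_outer tb).
set u1 := perturbed phi1 psi1 B1 delta.
set u2 := perturbed phi2 psi2 B2 delta.
suff npos : ~ ((exists2 q, closure (Omega1 h) q & 0 < u1 q) \/
    (exists2 q, closure (Omega2 h) q & 0 < u2 q)).
  by split=> p clp; rewrite leNgt; apply/negP => up; apply: npos;
    [left|right]; exists p.
move=> /(coercive_max2 (@closed_closure _ _) (@closed_closure _ _)
  (perturbed_continuous cphi1 cpsi1 (tb_continuous_inner tb))
  (perturbed_continuous cphi2 cpsi2 (tb_continuous_outer tb)) uX1 uX2).
move=> [m [m0 max1 max2 at_max]].
have Imax p : GammaI h p -> u1 p = m -> False.
  move=> pI u1m.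
  have u2m : u2 p = m.
    rewrite -u1m /u1 /u2 /perturbed (tb_interface tb pI).
    by rewrite (ts_continuity sphi pI) (ts_continuity spsi pI).
  have [d1 [d2 [Dphi1 Dphi2 Ephi]]] := ts_flux sphi pI.
  have [e1 [e2 [Dpsi1 Dpsi2 Epsi]]] := ts_flux spsi pI.
  have [b1 [b2 [DB1 DB2 Eb]]] := tb_flux tb pI.
  apply: (no_interface_max e10 e20 d0 (dh _) (h0 _) pI Dphi1 Dphi2 Ephi
    Dpsi1 Dpsi2 Epsi DB1 DB2 Eb) => q Oq; rewrite -/u1 -/u2 ?u1m ?u2m.
    by apply: max1; exact: subset_closure.
  by apply: max2; exact: subset_closure.
case: at_max => -[p clp um].
  have /andP[] := closure_Omega1 ch clp.
  rewrite le_eqVlt => /orP[/eqP p0 _|p0].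
    have pG : Gamma0 p by rewrite /Gamma0 /= -p0.
    have := mulr_ge0 (ltW d0) (tb_ge0_bottom tb pG).
    move: m0; rewrite -um /u1 /perturbed (ts_dirichlet sphi pG).
    by rewrite (ts_dirichlet spsi pG); lra.
  rewrite le_eqVlt => /orP[/eqP pI|ph]; first exact: Imax pI um.
  have Op : Omega1 h p by [].
  apply: (no_interior_max (open_Omega1 ch) Op C1phi C1psi _ d0
    (tb_superharmonic_inner tb Op)).
    by rewrite (ts_harmonic1 sphi Op) (ts_harmonic1 spsi Op).
  by move=> q Oq; have := max1 q (subset_closure Oq); rewrite -um.
have := closure_Omega2 ch clp; rewrite le_eqVlt => /orP[/eqP pI|Op].
  apply: (Imax p (esym pI)); rewrite -um /u1 /u2 /perturbed.
  rewrite (tb_interface tb (esym pI)).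
  by rewrite (ts_continuity sphi (esym pI)) (ts_continuity spsi (esym pI)).
apply: (no_interior_max (open_Omega2 ch) Op C2phi C2psi _ d0
  (tb_superharmonic_outer tb Op)).
  by rewrite (ts_harmonic2 sphi Op) (ts_harmonic2 spsi Op).
by move=> q Oq; have := max2 q (subset_closure Oq); rewrite -um.
Qed.

Lemma le_of_small_perturbation (a b : R) :
  (forall delta, 0 < delta -> a - delta * b <= 0) -> a <= 0.
Proof.
move=> H; rewrite leNgt; apply/negP => a0.
have b1 : 0 < `|b| + 1 by rewrite ltr_wpDl.
have := H (a / (`|b| + 1)) (divr_gt0 a0 b1); rewrite leNgt => /negP; apply.
rewrite subr_gt0 mulrAC ltr_pdivrMr// ltr_pM2l//.
by rewrite (le_lt_trans (ler_norm _))// ltrDl.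
Qed.

Lemma transmission_le (eps1 eps2 : R) (f h : R -> R)
    (phi1 phi2 psi1 psi2 B1 B2 : R * R -> R) :
  0 < eps1 -> 0 < eps2 ->
  (forall x, 0 < h x) -> (forall x, derivable h x 1) ->
  transmission_barrier eps1 eps2 h B1 B2 ->
  transmission_solution eps1 eps2 f h phi1 phi2 ->
  transmission_solution eps1 eps2 f h psi1 psi2 ->
  (forall p, closure (Omega1 h) p -> phi1 p <= psi1 p) /\
  (forall p, closure (Omega2 h) p -> phi2 p <= psi2 p).
Proof.
move=> e10 e20 h0 dh tb sphi spsi.
have H delta d0 := @transmission_perturbed_le0 _ _ delta _ _ _ _ _ _ _ _
  e10 e20 d0 h0 dh tb sphi spsi.
split=> p clp; rewrite -subr_le0.
  by apply: (@le_of_small_perturbation _ (B1 p)) => delta /H[+ _]; apply.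
by apply: (@le_of_small_perturbation _ (B2 p)) => delta /H[_]; apply.
Qed.

End Comparison.

(** * Periodic functions and regularity of the interface *)

Section Periodic.
Context {R : realType}.

Lemma periodic_intmul (g : R -> R) (T : R) : periodic g T ->
  forall (n : int) a, g (a + T *~ n) = g a.
Proof.
move=> gT [n|n] a; first by rewrite -pmulrn periodicn.
rewrite NegzE mulrNz -pmulrn -[RHS](congr1 g (subrK (T *+ n.+1) a)).
by rewrite periodicn.
Qed.

Lemma periodic_bounded (g : R -> R) (T : R) : 0 < T -> periodic g T ->
  continuous g -> exists M, forall x, `|g x| <= M.
Proof.
move=> T0 gT cg.
have [c _ cmax] := @EVT_max R (fun x => `|g x|) 0 T (ltW T0)
   (continuous_subspaceT (fun x => cvg_norm (cg x))).
exists `|g c| => x; pose n := Num.floor (x / T).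
rewrite -(subrK (T *~ n) x) periodic_intmul//; apply: cmax.
have /andP[n1 n2] := floor_itv (x / T).
rewrite in_itv/= -mulrzl subr_ge0 -ler_pdivlMr// n1/=.
rewrite lerBlDr -[X in X + _]mul1r -mulrDl -ler_pdivrMr// ltW//.
by rewrite addrC -[X in _ + X](mulr1z 1) -mulrzDr.
Qed.

Lemma periodic_derive1 (g : R -> R) (T : R) :
  periodic g T -> periodic (derive1 g) T.
Proof.
move=> gT x; rewrite /derive1.
suff -> : (fun h : R => h^-1 *: (g (h + (x + T)) - g (x + T))) =
  (fun h => h^-1 *: (g (h + x) - g x)) by [].
by apply/funext => t; rewrite addrA !gT.
Qed.

Lemma Ck_ge2 (k : nat) (h : R -> R) : (2 <= k)%N -> Ck k h ->
  [/\ forall x, derivable h x 1, forall x, derivable (derive1 h) x 1 &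
      continuous (derive1n 2 h)].
Proof.
move=> k2 [dh ch]; split=> [x|x|].
- exact: (dh 0%N x (leq_trans (isT : (0 < 2)%N) k2)).
- exact: (dh 1%N x k2).
move: k2; rewrite leq_eqVlt => /orP[/eqP -> //|k3] x.
exact: derivable1_continuous (dh 2%N x k3).
Qed.

End Periodic.

(** * Uniqueness *)

Theorem proposition1 (R : realType) (L eps1 eps2 : R) (k : nat) (f h : R -> R)
  (hL : 0 < L) (heps1 : 0 < eps1) (heps2 : 0 < eps2) (hk : (2 <= k)%N)
  (hfC : continuous f) (hfper : periodic f (2 * L))
  (hhper : periodic h (2 * L)) (hhC : Ck k h) (hhpos : forall x : R, 0 < h x)
  (phi1 phi2 psi1 psi2 : R * R -> R) :
  transmission_solution eps1 eps2 f h phi1 phi2 ->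
  transmission_solution eps1 eps2 f h psi1 psi2 ->
  (forall p, closure (Omega1 h) p -> phi1 p = psi1 p) /\
  (forall p, closure (Omega2 h) p -> phi2 p = psi2 p).
Proof.
move=> sphi spsi.
have [dh dh' ch''] := Ck_ge2 hk hhC.
have L0 : 0 < 2 * L by rewrite mulr_gt0.
have ch : continuous h by move=> x; exact: derivable1_continuous.
have [H hH] := periodic_bounded L0 hhper ch.
have h''per := periodic_derive1 (periodic_derive1 hhper).
have [K hK] := periodic_bounded L0 h''per ch''.
have hH' x : h x <= H by exact: le_trans (ler_norm _) (hH x).
have [B1 [B2 tb]] := barrier_exists heps1 heps2 hhpos dh dh' hH' hK.
have [le1 le2] := transmission_le heps1 heps2 hhpos dh tb sphi spsi.
have [ge1 ge2] := transmission_le heps1 heps2 hhpos dh tb spsi sphi.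
by split=> p clp; apply/eqP; rewrite eq_le ?le1 ?ge1 ?le2 ?ge2.
Qed.
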